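(* Let $\lambda\ge\kappa$ be infinite cardinals and let $(B_i:i\in I)$ be a family of boolean algebras each of which has the $(\lambda,\kappa)$-FN. Then the coproduct $B=\coprod_{i\in I}B_i$ (in the category of boolean algebras) has the $(\lambda,\kappa)$-FN.
   Context: For infinite cardinals $\lambda\ge\kappa$, a partial order $P$ has the $(\lambda,\kappa)$-FN iff there is a map $(f,g)\colon P\to[P]^{<\lambda}\times[P]^{<\kappa}$ such that for all $p\le q$ in $P$ there exist $r\in f(p)\cap g(q)$ with $p\le r\le q$ and $s\in g(p)\cap f(q)$ with $p\le s\le q$. Here $[P]^{<\mu}$ is the set of subsets of $P$ of cardinality less than $\mu$. A boolean algebra has the $(\lambda,\kappa)$-FN iff its underlying partial order does. The coproduct of boolean algebras is also known as their free product. *)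

(* Defs.v *)
From mathcomp Require Import all_boot all_order.
From mathcomp Require Import boolp classical_sets functions cardinality.

Set Implicit Arguments.
Unset Strict Implicit.
Unset Printing Implicit Defensive.

Import Order.Theory.
Local Open Scope card_scope.
Local Open Scope order_scope.

(* A cardinal is given by a type of that cardinality, and [card_lt A K] means
   |A| < |K|. *)
Definition card_lt (T : Type) (A : set T) (K : Type) : Prop :=
  A #<= [set: K]%classic /\ ~ ([set: K]%classic #<= A).

Definition has_FN (L K : Type) (d : Order.disp_t) (P : porderType d) : Prop :=
  exists f g : P -> set P,
    [/\ forall p, card_lt (f p) L,
        forall p, card_lt (g p) K &
        forall p q : P, p <= q ->
          (exists r, [/\ f p r, g q r & p <= r <= q]) /\
          (exists s, [/\ g p s, f q s & p <= s <= q])].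

(* [ctbDistrLatticeType] is the library's structure of boolean algebras (bottom
   and top are not assumed distinct).  The library's [{tblmorphism A -> B}] only
   requires preservation of bottom and top, hence this definition. *)
Definition bool_hom (d e : Order.disp_t) (A : ctbDistrLatticeType d)
    (B : ctbDistrLatticeType e) (h : A -> B) : Prop :=
  [/\ h \bot = \bot, h \top = \top,
      {morph h : x y / x `&` y},
      {morph h : x y / x `|` y} &
      {morph h : x / ~` x}].

Definition is_coproduct (I : Type) (d : I -> Order.disp_t)
    (A : forall i, ctbDistrLatticeType (d i))
    (e : Order.disp_t) (B : ctbDistrLatticeType e)
    (inj : forall i, A i -> B) : Prop :=
  (forall i, bool_hom (inj i)) /\
  forall (c : Order.disp_t) (C : ctbDistrLatticeType c) (u : forall i, A i -> C),
    (forall i, bool_hom (u i)) ->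
    exists h : B -> C,
      [/\ bool_hom h,
          forall i, h \o inj i =1 u i &
          forall h' : B -> C,
            bool_hom h' -> (forall i, h' \o inj i =1 u i) -> h' =1 h].

(* Main.v *)
From HB Require Import structures.
Require Import Defs.
From mathcomp Require Import all_boot all_order.
From mathcomp Require Import boolp classical_sets functions cardinality.

(* Every element of the coproduct is a finite join of boxes, i.e. of finite
   meets of elements [inj i a], and independence of the factors says that two
   boxes are disjoint only if they are disjoint in some coordinate.  Hence, for
   [p <= q], a box of [p] and a box of [~` q] are separated by some [inj i c]
   where [c] interpolates, in [A i], between a side [a] of a box of [p] and the
   complement of a side [b] of a box of [~` q]; a lattice combination of such
   elements interpolates between [p] and [q].  So [f p] is taken to be the
   sublattice generated by the [inj i c], with [c] in [f_i a], for the finitely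
   many sides [a] of the boxes of [p] and complements [a] of sides of the boxes
   of [~` p]; likewise for [g].  A sublattice generated by fewer than [L]
   elements has fewer than [L] elements: finitely generated distributive
   lattices are finite, and an infinite [X] satisfies [X * X <= X]. *)

Set Implicit Arguments.
Unset Strict Implicit.
Unset Printing Implicit Defensive.

Import Order.Theory.
Local Open Scope card_scope.
Local Open Scope classical_set_scope.

(** * Cardinal arithmetic *)

(** Zorn's lemma is applied to the sets whose union with [G] satisfies [P]. The empty chain is then
    settled by [P G]. *)
Lemma Zorn_above (T : Type) (P : set (set T)) (G : set T) :
    P G ->
    (forall F : set (set T), F !=set0 -> F `<=` P -> total_on F subset ->
      P (\bigcup_(X in F) X)) ->
  exists M, [/\ G `<=` M, P M & forall N, M `<=` N -> P N -> N `<=` M].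
Proof.
move=> PG Pchain.
have [|A [PA maxA]] := @Zorn_bigcup T (fun X => P (X `|` G)).
  move=> F FP Ftot; have [->|F0] := eqVneq F set0.
    by rewrite bigcup_set0 set0U.
  suff -> : \bigcup_(X in F) X `|` G = \bigcup_(Y in [set X `|` G | X in F]) Y.
    apply: Pchain.
    - by have /set0P[X FX] := F0; exists (X `|` G), X.
    - by move=> _ [X FX <-]; exact: FP.
    - move=> _ _ [X FX <-] [Y FY <-].
      by have [XY|YX] := Ftot X Y FX FY; [left|right]; exact: setSU.
  rewrite bigcup_image; apply/seteqP; split=> x.
    move=> [[X FX Xx]|Gx]; first by exists X => //; left.
    by have /set0P[X FX] := F0; exists X => //; right.
  by move=> [X FX [Xx|Gx]]; [left; exists X|right].
exists (A `|` G); split=> // N AN PN x Nx; apply: contrapT => Ax.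
apply: (maxA N); last by rewrite (setUidl _) // => y Gy; apply: AN; right.
by split=> [y Ay|/(_ x Nx) A'x]; [apply: AN; left|apply: Ax; left].
Qed.

Lemma chain_bigcup2 (T : Type) (F : set (set T)) (x y : T) :
  total_on F subset -> (\bigcup_(X in F) X) x -> (\bigcup_(X in F) X) y ->
  exists X, [/\ F X, X x & X y].
Proof.
move=> Ftot [X FX Xx] [Y FY Yy].
by have [XY|YX] := Ftot X Y FX FY; [exists Y|exists X]; split => //; auto.
Qed.

(** A maximal partial bijection [R] between [A] and [B] is total on one side, since otherwise a pair
    of unmatched elements could be added to it. *)
Lemma injection_total (X : Type) (A B : set X) :
  (exists f, {in A &, injective f} /\ f @` A `<=` B) \/
  (exists f, {in B &, injective f} /\ f @` B `<=` A).
Proof.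
pose P (R : set (X * X)) := [/\ forall p, R p -> A p.1 /\ B p.2,
  forall p q, R p -> R q -> p.1 = q.1 -> p = q &
  forall p q, R p -> R q -> p.2 = q.2 -> p = q].
have [||R [_ [RAB Rfun Rinj] Rmax]] := @Zorn_above _ P set0.
- by split.
- move=> F _ FP Ftot; split.
  + by move=> p [S FS Sp]; have [+ _ _] := FP S FS; apply.
  + move=> p q Fp Fq; have [S [FS Sp Sq]] := chain_bigcup2 Ftot Fp Fq.
    by have [_ + _] := FP S FS; apply.
  + move=> p q Fp Fq; have [S [FS Sp Sq]] := chain_bigcup2 Ftot Fp Fq.
    by have [_ _] := FP S FS; apply.
have [domR|/existsNP[a /not_implyP[Aa Ra]]] :=
    pselect (forall a, A a -> exists b, R (a, b)).
  have /choice[f Rf] : forall a, exists b, A a -> R (a, b).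
    by move=> a; have [/domR[b]|nAa] := pselect (A a); [exists b|exists a].
  left; exists f; split; last by move=> _ [a /Rf/RAB[_ /= Bfa] <-].
  move=> a b /set_mem Aa /set_mem Ab fab.
  by have [] := Rinj _ _ (Rf a Aa) (Rf b Ab) fab.
have [codR|/existsNP[b /not_implyP[Bb Rb]]] :=
    pselect (forall b, B b -> exists a, R (a, b)).
  have /choice[f Rf] : forall b, exists a, B b -> R (a, b).
    by move=> b; have [/codR[a']|nBb] := pselect (B b); [exists a'|exists b].
  right; exists f; split; last by move=> _ [b /Rf/RAB[/= Afb _] <-].
  move=> b c /set_mem Bb /set_mem Bc fbc.
  by have [] := Rfun _ _ (Rf b Bb) (Rf c Bc) fbc.
exfalso; have Ra' := Ra; apply: Ra; exists b.
apply: (Rmax (R `|` [set (a, b)])); [by move=> p Rp; left| |by right].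
split.
- by move=> p [/RAB//|->].
- move=> p q [Rp|->] [Rq|->] //; [by apply: Rfun|move=> /= pa|move=> /= aq]; exfalso.
    by apply: Ra' => //; exists p.2; rewrite -pa -surjective_pairing.
  by apply: Ra' => //; exists q.2; rewrite aq -surjective_pairing.
- move=> p q [Rp|->] [Rq|->] //; [by apply: Rinj|move=> /= pb|move=> /= bq]; exfalso.
    by apply: Rb; exists p.1; rewrite -pb -surjective_pairing.
  by apply: Rb; exists q.1; rewrite bq -surjective_pairing.
Qed.

(* [M (x, y, z)] reads [j x y = z] for an injection [j : D * D -> D]. *)
Definition pairing_dom (X : Type) (M : set (X * X * X)) : set X :=
  [set x | exists z, M (x, x, z)].

Definition is_pairing (X : Type) (M : set (X * X * X)) : Prop :=
  let D := pairing_dom M in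
  [/\ forall x y z z', M (x, y, z) -> M (x, y, z') -> z = z',
      forall x y x' y' z, M (x, y, z) -> M (x', y', z) -> x = x' /\ y = y',
      forall x y, D x -> D y -> exists z, M (x, y, z) &
      forall x y z, M (x, y, z) -> [/\ D x, D y & D z]].

Lemma is_pairing_bigcup (X : Type) (F : set (set (X * X * X))) :
  F `<=` @is_pairing X -> total_on F subset ->
  is_pairing (\bigcup_(M in F) M).
Proof.
move=> FP Ftot.
have domF M : F M -> pairing_dom M `<=` pairing_dom (\bigcup_(M in F) M).
  by move=> FM x [z Mz]; exists z, M.
split.
- move=> x y z z' Fz Fz'; have [M [FM Mz Mz']] := chain_bigcup2 Ftot Fz Fz'.
  by have [+ _ _ _] := FP M FM; apply; [exact: Mz|].
- move=> x y x' y' z Fz Fz'.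
  have [M [FM Mz Mz']] := chain_bigcup2 Ftot Fz Fz'.
  by have [_ + _ _] := FP M FM; apply; [exact: Mz|].
- move=> x y [z Fz] [z' Fz'].
  have [M [FM Mz Mz']] := chain_bigcup2 Ftot Fz Fz'.
  have [_ _ Mdom _] := FP M FM.
  have [w Mw] := Mdom x y (ex_intro _ z Mz) (ex_intro _ z' Mz').
  by exists w, M.
- move=> x y z [M FM Mxyz]; have [_ _ _ Mcl] := FP M FM.
  have [Dx Dy Dz] := Mcl x y z Mxyz.
  by split; [exact: domF Dx|exact: domF Dy|exact: domF Dz].
Qed.

(** The pairing of the natural numbers, carried along [nu], extends by Zorn to a maximal pairing
    [M], with domain [D]. It then suffices to embed [X] into [D]. *)
Lemma pairing_of_nat (X : Type) (nu : nat -> X) : injective nu ->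
  exists j : X -> X -> X,
    forall x y x' y', j x y = j x' y' -> x = x' /\ y = y'.
Proof.
move=> nu_inj.
pose M0 : set (X * X * X) :=
  [set p | exists m n, p = (nu m, nu n, nu (pickle (m, n)))].
have M0P : is_pairing M0.
  have D0 n : pairing_dom M0 (nu n) by exists (nu (pickle (n, n))), n, n.
  split.
  - by move=> x y z z' [m [n [-> -> ->]]] [m' [n' [/nu_inj -> /nu_inj -> ->]]].
  - move=> x y x' y' z [m [n [-> -> ->]]] [m' [n' [-> ->]]].
    by move=> /nu_inj /(pcan_inj pickleK) [-> ->].
  - move=> x y [_ [m [_ [-> _ _]]]] [_ [n [_ [-> _ _]]]].
    by exists (nu (pickle (m, n))), m, n.
  - by move=> x y z [m [n [-> -> ->]]].
have [|M [M0M MP Mmax]] := Zorn_above M0P.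
  by move=> F _; exact: is_pairing_bigcup.
have [Mfun Minj Mdom Mcl] := MP.
pose D := pairing_dom M.
have Dnu n : D (nu n).
  by exists (nu (pickle (n, n))); apply: M0M; exists n, n.
have [j jM] : exists j, forall x y, D x -> D y -> M (x, y, j x y).
  have /choice[j jM] : forall p : X * X, exists z, D p.1 -> D p.2 -> M (p, z).
    move=> [x y]; have [[Dx Dy]|nD] := pselect (D x /\ D y).
      by have [z] := Mdom x y Dx Dy; exists z.
    by exists x => Dx Dy; case: nD.
  by exists (fun x y => j (x, y)) => x y; exact: (jM (x, y)).
have jD x y : D x -> D y -> D (j x y).
  by move=> Dx Dy; have [] := Mcl _ _ _ (jM x y Dx Dy).
have j_inj x y x' y' : D x -> D y -> D x' -> D y' ->
    j x y = j x' y' -> x = x' /\ y = y'.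
  move=> Dx Dy Dx' Dy' jj; apply: (Minj _ _ _ _ (j x y)); first exact: jM.
  by rewrite jj; exact: jM.
(* If [D] embeds into its complement by [phi], then the pairing extends to
   [D] and [phi D] together, with the new values in [phi D]; otherwise the
   complement of [D], and hence all of [X], embeds into [D]. *)
have [[phi [phi_inj phiD]]|[phi [phi_inj phiD]]] := injection_total D (~` D).
  exfalso.
  have {}phiD x : D x -> ~ D (phi x) by move=> Dx; apply: phiD; exists x.
  have {}phi_inj x y : D x -> D y -> phi x = phi y -> x = y.
    by move=> Dx Dy; apply: phi_inj; exact: mem_set.
  (* Elements of [D] and of its copy [phi D] are written [e b u] with [u] in [D]; the flag [b] tells
     which of the two is meant. *)
  pose e (b : bool) x := if b then phi x else x.
  have De b x : D x -> D (e b x) -> b = false.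
    by case: b => // Dx /(phiD x Dx).
  have e_inj b b' x x' : D x -> D x' -> e b x = e b' x' -> b = b' /\ x = x'.
    move=> Dx Dx'; case: b; case: b' => /= E.
    - by split=> //; exact: phi_inj.
    - by case: (phiD x) => //; rewrite E.
    - by case: (phiD x') => //; rewrite -E.
    - by [].
  (* The flags are stored in the value, so that the three new blocks of pairs take disjoint sets of
     values in [phi D]. *)
  pose c (b b' : bool) x y := phi (j (nu (pickle (b, b'))) (j x y)).
  have c_inj b1 b2 b1' b2' x y x' y' : D x -> D y -> D x' -> D y' ->
      c b1 b2 x y = c b1' b2' x' y' -> [/\ b1 = b1', b2 = b2', x = x' & y = y'].
    move=> Dx Dy Dx' Dy' /phi_inj/=.
    move=> /(_ (jD _ _ (Dnu _) (jD _ _ Dx Dy)) (jD _ _ (Dnu _) (jD _ _ Dx' Dy'))).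
    move=> /(j_inj _ _ _ _ (Dnu _) (jD _ _ Dx Dy) (Dnu _) (jD _ _ Dx' Dy')).
    move=> [/nu_inj /(pcan_inj pickleK)[-> ->]].
    move=> /(j_inj _ _ _ _ Dx Dy Dx' Dy')[-> ->].
    by [].
  pose N := M `|` [set p | exists b1 b2 x y, [/\ D x, D y, b1 || b2 &
    p = (e b1 x, e b2 y, c b1 b2 x y)]].
  have DN b x : D x -> pairing_dom N (e b x).
    case: b => Dx; last by have [z Mz] := Dx; exists z; left.
    by exists (c true true x x); right; exists true, true, x, x.
  have DN' x : pairing_dom N x -> exists b u, D u /\ x = e b u.
    move=> [z [Mz|]]; first by exists false, x; split => //; exists z.
    by move=> [b1 [b2 [u [v [Du _ _ [-> _ _]]]]]]; exists b1, u.
  suff NP : is_pairing N.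
    (* Maximality would put [phi (nu 0)] into [D]. *)
    have NM := Mmax N (fun p => @or_introl _ _) NP.
    have /NM/Mcl[Dphi _ _] : N (phi (nu 0), phi (nu 0), c true true (nu 0) (nu 0)).
      by right; exists true, true, (nu 0), (nu 0).
    exact: phiD (Dnu 0) Dphi.
  (* Old triples have both arguments in [D], new ones at least one in [phi D]. *)
  have clash x y z : M (x, y, z) -> forall b1 b2 u v,
      D u -> D v -> b1 || b2 -> x = e b1 u -> y = e b2 v -> False.
    move=> /Mcl[Dx Dy _] b1 b2 u v Du Dv + xe ye.
    by rewrite (De b1 u) -?xe// (De b2 v) -?ye.
  split.
  - move=> x y z z' [Mz|[b1 [b2 [u [v [Du Dv b12 [-> -> ->]]]]]]].
      move=> [|[b1 [b2 [u [v [Du Dv b12 [xe ye _]]]]]]]; first exact: Mfun.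
      by case: (clash _ _ _ Mz _ _ _ _ Du Dv b12 xe ye).
    move=> [Mz|]; first by case: (clash _ _ _ Mz _ _ _ _ Du Dv b12).
    move=> [b1' [b2' [u' [v' [Du' Dv' b12' [xe ye ->]]]]]].
    have [-> ->] := e_inj _ _ _ _ Du Du' xe.
    by have [-> ->] := e_inj _ _ _ _ Dv Dv' ye.
  - move=> x y x' y' z [Mz|[b1 [b2 [u [v [Du Dv b12 [-> -> ->]]]]]]].
      move=> [|[b1 [b2 [u [v [Du Dv b12 [_ _ ze]]]]]]]; first exact: Minj.
      have [_ _ Dz] := Mcl _ _ _ Mz; move: Dz; rewrite ze => Dz; exfalso.
      by move: Dz; apply: phiD; exact: (jD _ _ (Dnu _) (jD _ _ Du Dv)).
    move=> [Mz|]; first have [_ _ Dz] := Mcl _ _ _ Mz.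
      by exfalso; move: Dz; apply: phiD; exact: (jD _ _ (Dnu _) (jD _ _ Du Dv)).
    move=> [b1' [b2' [u' [v' [Du' Dv' b12' [-> -> ze]]]]]].
    by have [-> -> -> ->] := c_inj _ _ _ _ _ _ _ _ Du Dv Du' Dv' ze.
  - move=> x y /DN'[b1 [u [Du ->]]] /DN'[b2 [v [Dv ->]]].
    have [b12|] := boolP (b1 || b2).
      by exists (c b1 b2 u v); right; exists b1, b2, u, v.
    by case: b1; case: b2 => //= _; exists (j u v); left; exact: jM.
  - move=> x y z [/Mcl[Dx Dy Dz]|[b1 [b2 [u [v [Du Dv b12 [-> -> ->]]]]]]].
      by split; [exact: (DN false x)|exact: (DN false y)|exact: (DN false z)].
    split; [exact: DN|exact: DN|apply: (DN true)].
    exact: (jD _ _ (Dnu _) (jD _ _ Du Dv)).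
have {}phiD x : ~ D x -> D (phi x) by move=> Dx; apply: phiD; exists x.
have {}phi_inj x y : ~ D x -> ~ D y -> phi x = phi y -> x = y.
  by move=> Dx Dy; apply: phi_inj; exact: mem_set.
have [pi [piD pi_inj]] : exists pi : X -> X, (forall x, D (pi x)) /\ injective pi.
  (* The tags [nu 0] and [nu 1] keep the images of [D] and of its complement apart. *)
  exists (fun x => if pselect (D x) then j (nu 0) x else j (nu 1) (phi x)); split.
    by move=> x; case: pselect => Dx; apply: jD => //; exact: phiD.
  move=> x y; case: pselect => Dx; case: pselect => Dy jxy.
  - by have [] := j_inj _ _ _ _ (Dnu _) Dx (Dnu _) Dy jxy.
  - by have [/nu_inj] := j_inj _ _ _ _ (Dnu _) Dx (Dnu _) (phiD _ Dy) jxy.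
  - by have [/nu_inj] := j_inj _ _ _ _ (Dnu _) (phiD _ Dx) (Dnu _) Dy jxy.
  - have [_] := j_inj _ _ _ _ (Dnu _) (phiD _ Dx) (Dnu _) (phiD _ Dy) jxy.
    exact: phi_inj.
exists (fun x y => j (pi x) (pi y)) => x y x' y'.
by move=> /(j_inj _ _ _ _ (piD _) (piD _) (piD _) (piD _))[/pi_inj -> /pi_inj ->].
Qed.

(** * Sets of cardinality below that of an infinite type *)

Lemma inj_on_card_le (T U : Type) (A : set T) (B : set U) (f : T -> U) :
  {in A &, injective f} -> f @` A `<=` B -> A #<= B.
Proof.
move=> f_inj fAB; apply: card_le_trans (subset_card_le fAB).
by have /card_eqPle[] := inj_card_eq f_inj.
Qed.

Lemma card_le_inj_on (T U : Type) (A : set T) (B : set U) (u : U) :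
  A #<= B -> exists f : T -> U, {in A &, injective f} /\ f @` A `<=` B.
Proof.
elim/Ppointed: U => U in B u *; first by case: (no u).
move=> /pcard_leP/injfunPex[f fAB f_inj]; exists f; split=> // _ [x Ax <-].
exact: fAB.
Qed.

Lemma infinite_nat_inj (T : Type) : infinite_set [set: T] ->
  exists nu : nat -> T, injective nu.
Proof.
move=> Tinf; have [t _] := infinite_setN0 Tinf.
have [nu [nu_inj _]] := card_le_inj_on t ((infiniteP _).1 Tinf).
by exists nu => m n; apply: nu_inj; rewrite in_setT.
Qed.

Lemma card_lt_finite (T K : Type) (A : set T) :
  infinite_set [set: K] -> finite_set A -> card_lt A K.
Proof.
move=> Kinf Afin; split; last by move=> /card_le_finite/(_ Afin).
have [n An] := Afin; apply: (@card_le_trans _ _ _ [set: nat]).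
  exact: finite_set_countable.
exact/infiniteP.
Qed.

Lemma card_lt_le (T U K : Type) (A : set T) (B : set U) :
  A #<= B -> card_lt B K -> card_lt A K.
Proof.
move=> AB [BK KB]; split; first exact: card_le_trans BK.
by move=> KA; apply: KB; exact: card_le_trans AB.
Qed.

(* If [K * K] is covered by [A] and [B], then either some row lies in [B] or
   every row meets [A]. *)
Lemma card_ltU (T K : Type) (A B : set T) : infinite_set [set: K] ->
  card_lt A K -> card_lt B K -> card_lt (A `|` B) K.
Proof.
move=> Kinf [AK KA] [BK KB]; have [nu nu_inj] := infinite_nat_inj Kinf.
have [j j_inj] := pairing_of_nat nu_inj.
split.
  have [f [f_inj _]] := card_le_inj_on (nu 0) AK.
  have [g [g_inj _]] := card_le_inj_on (nu 0) BK.
  apply: (@inj_on_card_le _ _ _ _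
    (fun x => if pselect (A x) then j (nu 0) (f x) else j (nu 1) (g x))) => //.
  move=> x y /set_mem ABx /set_mem ABy.
  case: pselect => Ax; case: pselect => Ay /j_inj[].
  - by move=> _; apply: f_inj; exact: mem_set.
  - by move=> /nu_inj.
  - by move=> /nu_inj.
  - by move=> _; apply: g_inj; apply: mem_set; [case: ABx|case: ABy].
move=> KAB.
have [t _] : (A `|` B) !=set0.
  apply: contrapT => /set0P/negP/negPn/eqP AB0.
  by apply: Kinf; apply: (card_le_finite KAB); rewrite AB0.
have [h [h_inj hAB]] := card_le_inj_on t KAB.
have {}h_inj x y : h x = h y -> x = y by apply: h_inj; rewrite in_setT.
have [[k Bk]|rowA] := pselect (exists k, forall l, B (h (j k l))).
  apply: KB; apply: (@inj_on_card_le _ _ _ _ (fun l => h (j k l))).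
    by move=> x y _ _ /h_inj/j_inj[].
  by move=> _ [l _ <-].
have /choice[r rA] : forall k, exists l, A (h (j k l)).
  move=> k; have /forallNP/(_ k)/existsNP[l nB] := rowA.
  by exists l; have [|//|//] := hAB (h (j k l)); exists (j k l).
apply: KA; apply: (@inj_on_card_le _ _ _ _ (fun k => h (j k (r k)))).
  by move=> x y _ _ /h_inj/j_inj[].
by move=> _ [k _ <-].
Qed.

Lemma card_lt_bigcup_seq (T K : Type) (S : choiceType) (s : seq S) (F : S -> set T) :
  infinite_set [set: K] -> (forall x, card_lt (F x) K) ->
  card_lt (\bigcup_(x in [set` s]) F x) K.
Proof.
move=> Kinf FK; rewrite bigcup_seq; elim: s => [|x s IHs].
  by rewrite big_nil; exact: card_lt_finite.
by rewrite big_cons; exact: card_ltU.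
Qed.

(** * Generated sublattices *)

Local Open Scope order_scope.

Inductive lattice_hull (d : Order.disp_t) (B : tbLatticeType d) (X : set B) :
    set B :=
  | hull_gen x of X x : lattice_hull X x
  | hull0 : lattice_hull X \bot
  | hull1 : lattice_hull X \top
  | hullI x y of lattice_hull X x & lattice_hull X y : lattice_hull X (x `&` y)
  | hullU x y of lattice_hull X x & lattice_hull X y : lattice_hull X (x `|` y).

(** By distributivity, elements of this shape are closed under meets and joins. Generators can thus
    be added one at a time, preserving finiteness. *)
Lemma lattice_hull_setU1 (d : Order.disp_t) (B : tbDistrLatticeType d)
    (X : set B) (x : B) :
  lattice_hull (x |` X) `<=`
    [set a `|` (b `&` x) | a in lattice_hull X & b in lattice_hull X].
Proof.
move=> y; elim=> {y}.
- move=> y [->|Xy].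
    by exists \bot; [exact: hull0|exists \top; [exact: hull1|rewrite join0x meet1x]].
  by exists y; [exact: hull_gen|exists \bot; [exact: hull0|rewrite meet0x joinx0]].
- by exists \bot; [exact: hull0|exists \bot; [exact: hull0|rewrite meet0x joinx0]].
- by exists \top; [exact: hull1|exists \bot; [exact: hull0|rewrite meet0x joinx0]].
- move=> _ _ _ [a Xa [b Xb <-]] _ [a' Xa' [b' Xb' <-]].
  exists (a `&` a'); first exact: hullI.
  (* This is the coefficient of [x] in the expanded product. *)
  exists ((a `&` b') `|` ((b `&` a') `|` (b `&` b'))).
    by apply: hullU; [exact: hullI|apply: hullU; exact: hullI].
  rewrite [RHS]meetUl !meetUr !meetUl -!joinA meetA.
  have -> : b `&` a' `&` x = b `&` x `&` a' by rewrite meetAC.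
  have -> : b `&` b' `&` x = b `&` x `&` (b' `&` x) by rewrite meetACA meetxx.
  by [].
- move=> _ _ _ [a Xa [b Xb <-]] _ [a' Xa' [b' Xb' <-]].
  exists (a `|` a'); first exact: hullU.
  by exists (b `|` b'); [exact: hullU|rewrite meetUl joinACA].
Qed.

Lemma finite_lattice_hull (d : Order.disp_t) (B : tbDistrLatticeType d)
  (X : set B) : finite_set X -> finite_set (lattice_hull X).
Proof.
move=> /finite_seqP[s ->]; elim: s => [|x s IHs].
  rewrite set_nil; apply: sub_finite_set (finite_set2 \bot \top).
  move=> y; elim=> {y} [//|||y z _ + _|y z _ + _]; [by left|by right| |].
    by move=> [->|->] [->|->]; rewrite ?meet0x ?meet1x //=; auto.
  by move=> [->|->] [->|->]; rewrite ?join0x ?join1x //=; auto.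
have -> : [set` x :: s] = x |` [set` s].
  by apply/seteqP; split=> y; rewrite /= inE => /predU1P.
apply: sub_finite_set (@lattice_hull_setU1 _ _ _ _) _.
exact: finite_image2.
Qed.

(** Syntax for the members of a generated sublattice; unlike these members, terms can be coded by
    recursion. *)
Inductive term (X : Type) : Type :=
  | Gen of X | Bot | Top | Meet of term X & term X | Join of term X & term X.
Arguments Bot {X}.
Arguments Top {X}.

Fixpoint eval_term (X : Type) (d : Order.disp_t) (B : tbLatticeType d)
    (v : X -> B) (t : term X) : B :=
  match t with
  | Gen x => v x
  | Bot => \bot
  | Top => \top
  | Meet t u => eval_term v t `&` eval_term v u
  | Join t u => eval_term v t `|` eval_term v u
  end.

(** Each constructor has its own tag among [nu 0] to [nu 4], and [j] packs the tag with the codes of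
    the arguments. *)
Lemma term_code_inj (X : Type) (nu : nat -> X) :
  injective nu -> exists code : term X -> X, injective code.
Proof.
move=> nu_inj; have [j j_inj] := pairing_of_nat nu_inj.
pose fix code (t : term X) : X :=
  match t with
  | Gen x => j (nu 0) x
  | Bot => j (nu 1) (nu 0)
  | Top => j (nu 2) (nu 0)
  | Meet t u => j (nu 3) (j (code t) (code u))
  | Join t u => j (nu 4) (j (code t) (code u))
  end.
exists code; elim=> [x|||t IHt u IHu|t IHt u IHu] [y|||t' u'|t' u'] //= /j_inj[];
  try by move=> /nu_inj.
- by move=> _ ->.
- by move=> _ /j_inj[/IHt -> /IHu ->].
- by move=> _ /j_inj[/IHt -> /IHu ->].
Qed.

(** For infinite [X] the hull is covered by the values of terms over [X], and these terms embed into
    [X]. Finite [X] is treated apart: it has infinitely many terms, and [K] may be countable. *)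
Lemma card_lt_lattice_hull (K : Type) (d : Order.disp_t)
    (B : tbDistrLatticeType d) (X : set B) :
  infinite_set [set: K] -> card_lt X K -> card_lt (lattice_hull X) K.
Proof.
move=> Kinf XK; have [Xfin|Xinf] := pselect (finite_set X).
  by apply: card_lt_finite => //; exact: finite_lattice_hull.
have [|nu nu_inj] := @infinite_nat_inj (set_type X).
  move/card_le_finite => Xfin; apply: Xinf; apply: Xfin.
  by have /card_eqPle[] := card_setT X.
have [code code_inj] := term_code_inj nu_inj.
apply: card_lt_le XK; have /card_eqPle[leX _] := card_setT X.
apply: card_le_trans leX.
apply: (@card_le_trans _ _ _ [set: term (set_type X)]).
  apply: card_le_trans (card_image_le (eval_term val) setT).
  apply: subset_card_le => y; elim=> {y} [y Xy|||y z _ + _|y z _ + _].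
  - by exists (Gen (SigSub (mem_set Xy))).
  - by exists Bot.
  - by exists Top.
  - by move=> [t _ <-] [u _ <-]; exists (Meet t u).
  - by move=> [t _ <-] [u _ <-]; exists (Join t u).
by apply: (@inj_on_card_le _ _ _ _ code) => // x y _ _ /code_inj.
Qed.

(** * Boolean algebras and coproducts *)

(** A maximal proper filter containing [x] is an ultrafilter, and its characteristic function is the
    homomorphism wanted. *)
Lemma bool_hom_separates (d : Order.disp_t) (A : ctbDistrLatticeType d) (x : A) :
  x != \bot -> exists h : A -> bool, bool_hom h /\ h x.
Proof.
move=> x0.
pose is_filter (F : set A) := [/\ ~ F \bot, forall a b, F a -> F b -> F (a `&` b)
  & forall a b, a <= b -> F a -> F b].
have [||M [xM [M0 MI Mup] Mmax]] := @Zorn_above _ is_filter [set y | x <= y].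
- split=> [/=|a b /= xa xb|a b ab /= xa]; first by rewrite lex0; exact/negP.
    by rewrite lexI xa.
  exact: le_trans ab.
- move=> F [X0 FX0] FP Ftot; split.
  + by move=> [X FX]; have [] := FP X FX.
  + move=> a b Fa Fb; have [X [FX Xa Xb]] := chain_bigcup2 Ftot Fa Fb.
    by have [_ XI _] := FP X FX; exists X => //; exact: XI.
  + move=> a b ab [X FX Xa]; have [_ _ Xup] := FP X FX.
    by exists X => //; exact: Xup Xa.
have Mx : M x by apply: xM => /=.
have Mtop : M \top by apply: Mup Mx; exact: lex1.
have Mprime a : ~ M a -> M (~` a).
  move=> Ma; apply: contrapT => Mca; apply: Ma.
  (* The filter generated by [M] and [a] is proper: an [m] in [M] disjoint from [a] would lie below
     the complement of [a], which is not in [M]. *)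
  apply: (Mmax [set y | exists2 m, M m & m `&` a <= y]).
  - by move=> m Mm; exists m => //; exact: leIl.
  - split.
    + move=> [m Mm]; rewrite lex0 => /eqP ma; apply: Mca; apply: Mup Mm.
      by rewrite -disj_leC ma.
    + move=> b c [m Mm mb] [n Mn nc]; exists (m `&` n); first exact: MI.
      rewrite lexI (le_trans _ mb) ?(le_trans _ nc)//.
        by rewrite leI2// leIr.
      by rewrite leI2// leIl.
    + by move=> b c bc [m Mm mb]; exists m => //; exact: le_trans bc.
  - by exists \top => //; rewrite meet1x.
have MC a : M (~` a) <-> ~ M a.
  by split=> [Mca Ma|]; [apply: M0; rewrite -(meetxC a); exact: MI|exact: Mprime].
have MII a b : M (a `&` b) <-> M a /\ M b.
  split=> [Mab|[]]; last exact: MI.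
  by split; apply: Mup Mab; [exact: leIl|exact: leIr].
exists (fun a => `[< M a >]); split; last exact/asboolP.
have hI a b : `[< M (a `&` b) >] = `[< M a >] && `[< M b >].
  by apply/asboolP/andP => [/MII[? ?]|[/asboolP ? /asboolP ?]];
    [split; exact/asboolP|exact/MII].
have hC a : `[< M (~` a) >] = ~~ `[< M a >].
  apply/asboolP/negP => [/MC nMa /asboolP|nMa]; first exact: nMa.
  by apply/MC => /asboolP.
split=> //.
- by apply/asboolP.
- by apply/asboolP.
- move=> a b; apply: negb_inj; rewrite -hC complU hI !hC.
  by rewrite -negb_or.
Qed.

(** * Subalgebras, and generation of a coproduct by its factors *)

Section Subalgebra.
Variables (d : Order.disp_t) (B : ctbDistrLatticeType d) (S : {pred B}).
Hypotheses (S0 : \bot \in S) (S1 : \top \in S)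
  (SI : {in S &, forall x y, x `&` y \in S})
  (SU : {in S &, forall x y, x `|` y \in S})
  (SC : {in S, forall x, ~` x \in S}).

Definition subalgebra := {x : B | x \in S}.
HB.instance Definition _ := SubChoice.on subalgebra.

HB.instance Definition _ := Order.SubChoice_isTBSubLattice.Build d B S d subalgebra
  SI SU S0 S1.

Let valI : {morph (val : subalgebra -> B) : x y / x `&` y}.
Proof. exact: Order.valI_subproof. Qed.

Let valU : {morph (val : subalgebra -> B) : x y / x `|` y}.
Proof. exact: Order.valU_subproof. Qed.

Let val0 : (val : subalgebra -> B) \bot = \bot.
Proof. exact: Order.val0_subproof. Qed.

Let val1 : (val : subalgebra -> B) \top = \top.
Proof. exact: Order.val1_subproof. Qed.

Fact subalgebra_meetUl :
  @left_distributive subalgebra subalgebra Order.meet Order.join.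
Proof. by move=> x y z; apply: val_inj; rewrite !(valI, valU) meetUl. Qed.

HB.instance Definition _ :=
  Order.Lattice_Meet_isDistrLattice.Build d subalgebra subalgebra_meetUl.

Let sub_compl (x : subalgebra) : subalgebra := Sub (~` val x) (SC (valP x)).

Fact sub_joinxC x : x `|` sub_compl x = \top.
Proof. by apply: val_inj; rewrite valU SubK joinxC val1. Qed.

Fact sub_meetxC x : x `&` sub_compl x = \bot.
Proof. by apply: val_inj; rewrite valI SubK meetxC val0. Qed.

HB.instance Definition _ := Order.TBDistrLattice_hasComplement.Build d subalgebra
  sub_joinxC sub_meetxC.

(** The injections factor through the subalgebra on [S]. The induced [h], followed by the inclusion,
    is an endomorphism of [B] fixing every [inj i a], hence the identity by uniqueness. *)
Lemma coproduct_generated (I : Type) (dA : I -> Order.disp_t)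
    (A : forall i, ctbDistrLatticeType (dA i)) (inj : forall i, A i -> B) :
  is_coproduct inj -> (forall i a, inj i a \in S) -> forall b, b \in S.
Proof.
move=> [inj_hom inj_univ] Sinj b.
pose u i (a : A i) : subalgebra := Sub (inj i a) (Sinj i a).
have u_hom i : bool_hom (u i).
  have [i0 i1 iI iU iC] := inj_hom i.
  by split=> [||x y|x y|x]; apply: val_inj;
    rewrite ?(valI, valU, val0, val1) /= ?i0 ?i1 ?iI ?iU ?iC.
have [h [[h0 h1 hI hU hC] hu _]] := inj_univ _ subalgebra u u_hom.
have [k [_ _ k_uniq]] := inj_univ _ B inj inj_hom.
have <- : val (h b) = b; last exact: valP.
have kid : id b = k b by apply: k_uniq.
rewrite [RHS]kid; apply: (k_uniq (fun x => val (h x))).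
  by split=> [||x y|x y|x] /=; rewrite ?h0 ?h1 ?hI ?hU ?hC.
by move=> i a /=; have /= -> := hu i a.
Qed.

End Subalgebra.

(** * Finite joins and their separation *)

Inductive joins (d : Order.disp_t) (B : bJoinSemilatticeType d) (R : set B) :
    set B :=
  | joins0 : joins R \bot
  | joinsU r x of R r & joins R x : joins R (r `|` x).

Section Joins.
Variables (d : Order.disp_t) (B : tbDistrLatticeType d).
Implicit Types (R Z : set B) (x y : B).

Lemma joins_subset R R' : R `<=` R' -> joins R `<=` joins R'.
Proof. by move=> RR' x; elim=> [|r y /RR' R'r _]; [exact: joins0|exact: joinsU]. Qed.

Lemma joins_gen R : R `<=` joins R.
Proof. by move=> r Rr; rewrite -[r]joinx0; apply: joinsU => //; exact: joins0. Qed.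

Lemma joins_join R x y : joins R x -> joins R y -> joins R (x `|` y).
Proof.
by move=> + Ry; elim=> [|r z Rr _ IH]; rewrite ?join0x// -joinA; exact: joinsU.
Qed.

Lemma joins_meet R x y : (forall r s, R r -> R s -> R (r `&` s)) ->
  joins R x -> joins R y -> joins R (x `&` y).
Proof.
move=> RI + Ry; elim=> [|r z Rr _ IH]; first by rewrite meet0x; exact: joins0.
rewrite meetUl; apply: joins_join => //; elim: Ry => [|s w Rs _ {}IH].
  by rewrite meetx0; exact: joins0.
by rewrite meetUr; apply: joinsU => //; exact: RI.
Qed.

(** If [z_ij] separates the joinand [r_i] of [x] from the joinand [r'_j] of [y], then the join over
    [i] of the meets over [j] of the [z_ij] separates [x] from [y]. Empty joins and meets give
    [\bot] and [\top]. *)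
Lemma joins_separation R R' Z : Z \bot -> Z \top ->
    (forall x y, Z x -> Z y -> Z (x `&` y)) ->
    (forall x y, Z x -> Z y -> Z (x `|` y)) ->
    (forall r r', R r -> R' r' -> r `&` r' = \bot ->
      exists z, [/\ Z z, r <= z & z `&` r' = \bot]) ->
  forall x y, joins R x -> joins R' y -> x `&` y = \bot ->
    exists z, [/\ Z z, x <= z & z `&` y = \bot].
Proof.
move=> Z0 Z1 ZI ZU RR' x y + R'y.
elim=> [_|r {}x Rr _ IHx]; first by exists \bot; rewrite meet0x.
rewrite meetUl => /eqP; rewrite join_eq0 => /andP[/eqP ry /eqP /IHx[z [Zz xz zy]]].
suff [w [Zw rw wy]] : exists w, [/\ Z w, r <= w & w `&` y = \bot].
  exists (w `|` z); split; [exact: ZU|exact: leU2|].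
  by rewrite meetUl wy zy joinx0.
elim: R'y ry {IHx z Zz xz zy} => [_|r' {}y Rr' _ IHy].
  by exists \top; rewrite lex1 meetx0.
rewrite meetUr => /eqP; rewrite join_eq0 => /andP[/eqP rr' /eqP /IHy[w [Zw rw wy]]].
have [z [Zz rz zr']] := RR' _ _ Rr Rr' rr'.
exists (z `&` w); split; [exact: ZI|by rewrite lexI rz|].
by rewrite meetUr meetAC zr' meet0x join0x -meetA wy meetx0.
Qed.

End Joins.

(** * Boxes in the coproduct *)

Section Boxes.
Variables (I : choiceType) (d : I -> Order.disp_t)
  (A : forall i, ctbDistrLatticeType (d i))
  (e : Order.disp_t) (B : ctbDistrLatticeType e) (inj : forall i, A i -> B).

Notation lit := {i : I & A i}.
Implicit Types (s t : seq I) (a b : forall i, A i) (l m : seq lit) (r : B).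

Definition box s a : B := \meet_(i <- s) inj (a i).

(** With trivial sides off [s], a box lies below [inj (a i)] for every [i], so boxes over different
    index lists can be handled coordinate by coordinate. *)
Definition supported s a : Prop := forall i, i \notin s -> a i = \top.

(* [box_in l r]: [r] is a box all of whose nontrivial sides occur in [l]. *)
Definition box_in l r : Prop := exists s a,
  [/\ supported s a, forall i, i \in s -> Tagged A (a i) \in l & r = box s a].

Definition is_box r : Prop := exists s a, supported s a /\ r = box s a.

Lemma box_in_subset l m : {subset l <= m} -> box_in l `<=` box_in m.
Proof. by move=> lm r [s [a [sa la ->]]]; exists s, a; split=> // i /la/lm. Qed.

Lemma joins_box_in x : joins is_box x -> exists l, joins (box_in l) x.
Proof.
elim=> [|r y [s [a [sa ->]]] _ [l ly]]; first by exists [::]; exact: joins0.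
exists ([seq Tagged A (a i) | i <- s] ++ l); apply: joinsU.
  exists s, a; split=> // i si.
  by rewrite mem_cat; apply/orP; left; apply/mapP; exists i.
by apply: joins_subset ly; apply: box_in_subset => k lk; rewrite mem_cat lk orbT.
Qed.

Definition lit_compl (k : lit) : lit := Tagged A (~` tagged k).

Definition hull (F : forall i, A i -> set (A i)) l : set B :=
  lattice_hull (\bigcup_(k in [set` l]) (@inj (tag k) @` F (tag k) (tagged k))).

Lemma hull_subset F l m : {subset l <= m} -> hull F l `<=` hull F m.
Proof.
move=> lm z; elim=> {z} [z [k lk Fk]|||x y _ + _|x y _ + _].
- by apply: hull_gen; exists k => //; exact: lm.
- exact: hull0.
- exact: hull1.
- exact: hullI.
- exact: hullU.
Qed.

Hypothesis inj_coproduct : is_coproduct inj.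

Let inj_le i (x y : A i) : x <= y -> inj x <= inj y.
Proof.
have [_ _ injI _ _] := inj_coproduct.1 i.
by move=> /meet_idPl xy; apply/meet_idPl; rewrite -injI xy.
Qed.

Lemma box_le s a i : supported s a -> box s a <= inj (a i).
Proof.
move=> sa; have [si|/sa ->] := boolP (i \in s); first exact: meets_inf_seq.
by have [_ -> _ _ _] := inj_coproduct.1 i; exact: lex1.
Qed.

Lemma le_box r s a : (forall i, r <= inj (a i)) -> r <= box s a.
Proof. by move=> ra; apply/meetsP_seq => i _ _; exact: ra. Qed.

Lemma is_boxI r r' : is_box r -> is_box r' -> is_box (r `&` r').
Proof.
move=> [s [a [sa ->]]] [t [b [tb ->]]].
have stab : supported (s ++ t) (fun i => a i `&` b i).
  by move=> i; rewrite mem_cat negb_or => /andP[/sa -> /tb ->]; rewrite meetxx.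
exists (s ++ t), (fun i => a i `&` b i); split=> //; apply/le_anti/andP; split.
  apply: le_box => i; have [_ _ -> _ _] := inj_coproduct.1 i.
  by rewrite leI2//; exact: box_le.
by rewrite lexI; apply/andP; split; apply: le_box => i;
  apply: le_trans (box_le i stab) (inj_le _); [exact: leIl|exact: leIr].
Qed.

Lemma is_box_inj i (x : A i) : is_box (inj x).
Proof.
exists [:: i], (dfwith (fun j => \top : A j) x); split=> [j|].
  by rewrite inE eq_sym => ij; rewrite dfwith_out.
by rewrite /box big_seq1 dfwith_in.
Qed.

(** By De Morgan, the complement of a box is the join of the complements of its sides; the
    complement of a join of boxes is a meet of such joins, which is multiplied out. *)
Lemma joins_is_boxC x : joins is_box x -> joins is_box (~` x).
Proof.
have boxes1 : joins is_box \top.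
  apply: joins_gen; exists [::], (fun i => \top).
  by split=> //; rewrite /box big_nil.
elim=> [|r y [s [a [sa ->]]] _ IH]; first by rewrite compl0.
rewrite complU; apply: joins_meet => //; first exact: is_boxI.
rewrite compl_meets; elim/big_ind: _ => [||i _].
- exact: joins0.
- by move=> u v; exact: joins_join.
have [_ _ _ _ <-] := inj_coproduct.1 i.
by apply: joins_gen; exact: is_box_inj.
Qed.

(** Finite joins of boxes form a subalgebra containing the images of all factors, and these generate
    [B]. *)
Lemma joins_boxes x : joins is_box x.
Proof.
pose S : {pred B} := [pred y | `[< joins is_box y >]].
suff /asboolP : x \in S by [].
apply: (coproduct_generated _ _ _ _ _ inj_coproduct) => [||y z|y z|y|i a].
- by apply/asboolP; exact: joins0.
- by apply/asboolP; rewrite -compl0; apply: joins_is_boxC; exact: joins0.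
- move=> /asboolP Sy /asboolP Sz; apply/asboolP; apply: joins_meet => //.
  exact: is_boxI.
- by move=> /asboolP Sy /asboolP Sz; apply/asboolP; exact: joins_join.
- by move=> /asboolP Sy; apply/asboolP; exact: joins_is_boxC.
- by apply/asboolP; apply: joins_gen; exact: is_box_inj.
Qed.

(** If no coordinate were disjoint, homomorphisms [h i] to [bool], true at the meet of [a i] and
    [b i], would induce a [g] on [B] that is true at both boxes, hence at their meet [\bot]. *)
Lemma disjoint_boxes s t a b :
  box s a `&` box t b = \bot -> exists i, a i `&` b i = \bot.
Proof.
move=> st0; apply: contrapT => /forallNP ab0.
have hom i := cid (bool_hom_separates (introN eqP (ab0 i))).
pose h i := projT1 (hom i).
have hP i : bool_hom (h i) /\ h i (a i `&` b i) := projT2 (hom i).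
have [g [[g0 g1 gI _ _] gh _]] := inj_coproduct.2 _ _ h (fun i => (hP i).1).
have g_inj i (x : A i) : g (inj x) = h i x by exact: gh.
have g_box u c : (forall i, h i (c i)) -> g (box u c).
  move=> hc; rewrite /box; elim/big_ind: _ => [|x y gx gy|i _].
  - by rewrite g1.
  - by rewrite gI gx gy.
  - by rewrite g_inj.
have hI i : h i (a i) && h i (b i).
  by have [[_ _ hI _ _]] := hP i; rewrite hI.
suff : g \bot by rewrite g0.
rewrite -st0 gI; apply/andP; split; apply: g_box => i; by case/andP: (hI i).
Qed.

(** * Interpolation between joins of boxes *)

Section Interpolation.
Variables F G : forall i, A i -> set (A i).
Hypothesis FG : forall i (x y : A i), x <= y ->
  exists c, [/\ F x c, G y c & x <= c <= y].

(** At a disjoint coordinate [i], the side [a i] lies below the complement of [b i]; the [c] that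
    [FG] puts between them yields [inj c]. *)
Lemma box_separation l m r r' : box_in l r -> box_in m r' -> r `&` r' = \bot ->
  exists z, [/\ (hull F l `&` hull G (map lit_compl m))%classic z, r <= z &
    z `&` r' = \bot].
Proof.
move=> [s [a [sa la rE]]] [t [b [tb mb r'E]]] rr'.
have [i ab0] : exists i, a i `&` b i = \bot.
  by apply: (@disjoint_boxes s t); rewrite -rE -r'E.
have [inj0 _ _ _ injC] := inj_coproduct.1 i.
have r_le : r <= inj (a i) by rewrite rE; exact: box_le.
have r'_le : r' <= inj (b i) by rewrite r'E; exact: box_le.
(* Off [s] the side [a i] is [\top] and need not occur in [l]; but then [b i], and with it [r'], is
   [\bot]. *)
have [si|nsi] := boolP (i \in s); last first.
  exists \top; split; [by split; exact: hull1|exact: lex1|].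
  move: r'_le; rewrite -[b i]meet1x -(sa i nsi) ab0 inj0 lex0 => /eqP ->.
  by rewrite meetx0.
have [ti|nti] := boolP (i \in t); last first.
  exists \bot; split; [by split; exact: hull0| |by rewrite meet0x].
  by move: r_le; rewrite -[a i]meetx1 -(tb i nti) ab0 inj0.
have /FG[c [Fc Gc /andP[ac cb]]] : a i <= ~` b i by rewrite -disj_leC ab0.
exists (inj c); split.
- split; apply: hull_gen.
    by exists (Tagged A (a i)); [exact: la|exists c].
  exists (lit_compl (Tagged A (b i))); last by exists c.
  by rewrite /= map_f// mb.
- exact: le_trans r_le (inj_le ac).
- apply/eqP; rewrite disj_leC; apply: le_trans (inj_le cb) _.
  by rewrite injC leC.
Qed.

(** To interpolate between [p] and [q] is to separate [p] from the complement of [q]. The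
    intersection of the two hulls is a sublattice, so separation passes from boxes to their
    joins. *)
Lemma hull_interpolation l m p q :
  joins (box_in l) p -> joins (box_in m) (~` q) -> p <= q ->
  exists z, [/\ hull F l z, hull G (map lit_compl m) z & p <= z <= q].
Proof.
move=> lp mq pq.
have [|||||z [[Fz Gz] pz zq]] :=
  joins_separation _ _ _ _ (@box_separation l m) lp mq.
- by split; exact: hull0.
- by split; exact: hull1.
- by move=> x y [? ?] [? ?]; split; exact: hullI.
- by move=> x y [? ?] [? ?]; split; exact: hullU.
- by apply/eqP; rewrite disj_leC complK.
by exists z; split=> //; rewrite pz /= -[q]complK -disj_leC zq.
Qed.

End Interpolation.

End Boxes.

(** * The FN property of the coproduct *)

Lemma coproduct_FN (L K : Type) (I : choiceType) (d : I -> Order.disp_t)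
    (A : forall i, ctbDistrLatticeType (d i)) (e : Order.disp_t)
    (B : ctbDistrLatticeType e) (inj : forall i, A i -> B) :
  infinite_set [set: L] -> infinite_set [set: K] ->
  (forall i, has_FN L K (A i)) -> is_coproduct inj -> has_FN L K B.
Proof.
move=> Linf Kinf A_FN B_coproduct.
pose f i := projT1 (cid (A_FN i)).
pose g i := projT1 (cid (projT2 (cid (A_FN i)))).
have fgP i : [/\ forall p, card_lt (f i p) L, forall p, card_lt (g i p) K &
    forall p q, p <= q -> (exists r, [/\ f i p r, g i q r & p <= r <= q]) /\
                          (exists s, [/\ g i p s, f i q s & p <= s <= q])].
  exact: projT2 (cid (projT2 (cid (A_FN i)))).
have /choice[l lP] : forall p, exists l, joins (box_in inj l) p.
  by move=> p; exact/joins_box_in/joins_boxes.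
(* Both roles of [p] are served: the first list when [p] is the lower element, the second when it is
   the upper one. *)
pose supp p := l p ++ map (@lit_compl _ _ A) (l (~` p)).
have hull_lt (M : Type) (F : forall i, A i -> set (A i)) p :
    infinite_set [set: M] -> (forall i x, card_lt (F i x) M) ->
    card_lt (hull inj F (supp p)) M.
  move=> Minf FM; apply: card_lt_lattice_hull => //.
  apply: card_lt_bigcup_seq => // k.
  by apply: card_lt_le (FM _ _); exact: card_image_le.
have interp (F G : forall i, A i -> set (A i)) p q :
    (forall i (x y : A i), x <= y ->
      exists c, [/\ F i x c, G i y c & x <= c <= y]) -> p <= q ->
    exists z, [/\ hull inj F (supp p) z, hull inj G (supp q) z & p <= z <= q].
  move=> FG pq.
  have [z [Fz Gz pzq]] :=
    hull_interpolation B_coproduct FG (lP p) (lP (~` q)) pq.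
  exists z; split=> //; [apply: hull_subset Fz|apply: hull_subset Gz];
    by move=> k kl; rewrite mem_cat kl ?orbT.
exists (fun p => hull inj f (supp p)), (fun p => hull inj g (supp p)); split.
- by move=> p; apply: hull_lt => // i x; have [+ _ _] := fgP i; apply.
- by move=> p; apply: hull_lt => // i x; have [_ + _] := fgP i; apply.
(* The second clause is the first with [f] and [g] exchanged. *)
- move=> p q pq; split; apply: interp => // i x y xy;
    by have [_ _ /(_ x y xy)[]] := fgP i.
Qed.

Theorem theorem2p6 (L K : Type)
    (K_infinite : infinite_set [set: K]%classic)
    (L_infinite : infinite_set [set: L]%classic)
    (K_le_L : ([set: K] #<= [set: L])%card)
    (I : Type) (d : I -> Order.disp_t)
    (A : forall i, ctbDistrLatticeType (d i))
    (A_FN : forall i, has_FN L K (A i))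
    (e : Order.disp_t) (B : ctbDistrLatticeType e)
    (inj : forall i, A i -> B)
    (B_coproduct : is_coproduct inj) :
  has_FN L K B.
Proof.
(* [{classic I}] equips [I] with the choice structure used for lists of indices. *)
exact: (@coproduct_FN L K {classic I} d A e B inj).
Qed.
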